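(* Let $X \subseteq \mathbb{P}^n$ be a quadric of rank at least three over $\mathbb{K}$. Then the complement $Y = \mathbb{P}^n \setminus X$ is flexible.
   Context: $\mathbb{K}$ is an algebraically closed field of characteristic zero; a variety is an integral separated scheme of finite type over $\mathbb{K}$. The rank of a quadric is the rank of a quadratic form defining it. The complement of a hypersurface in $\mathbb{P}^n$ is an affine variety. $\mathbb{G}_\mathrm{a} = (\mathbb{K},+)$ is the one-dimensional additive algebraic group. For a variety $Y$, a smooth point $y \in Y$ is flexible if the tangent space $T_yY$ is spanned by tangent vectors to orbits of effective (algebraic) $\mathbb{G}_\mathrm{a}$-actions on $Y$; $Y$ is flexible if every smooth point of $Y$ is flexible. *)

(* Defs.v *)
From HB Require Import structures.
From mathcomp Require Import all_boot all_order all_algebra.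
From mathcomp Require Import mpoly.

Set Implicit Arguments.
Unset Strict Implicit.
Unset Printing Implicit Defensive.

Import GRing.Theory.
Local Open Scope ring_scope.

(* Varieties are treated in the classical language: since K is algebraically
   closed, a variety is determined by its closed points, its Zariski topology
   and its sheaf of regular K-valued functions.  A space with functions is a
   set with a topology and a sheaf of K-valued functions, closed under the
   K-algebra operations and under inversion.  Being of finite type, separated
   and irreducible is not part of the structure: it holds for the open subsets
   of P^n, and the notions below are stated for arbitrary spaces.

   The sheaf is given by its germs: [regular_at x f] says that f is regular on
   some neighbourhood of x; the values of f away from x are irrelevant.        *)
Record space (K : fieldType) := Space {
  pt :> Type;
  is_open : (pt -> Prop) -> Prop;
  regular_at : pt -> (pt -> K) -> Prop;
  openT : is_open (fun _ => True);
  openI : forall U V, is_open U -> is_open V -> is_open (fun x => U x /\ V x);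
  open_locally : forall U,
    (forall x, U x -> exists V, [/\ is_open V, V x & forall y, V y -> U y]) ->
    is_open U;
  regular_near : forall x f, regular_at x f ->
    exists U, [/\ is_open U, U x & forall y, U y -> regular_at y f];
  regular_local : forall x f g U, is_open U -> U x ->
    (forall y, U y -> f y = g y) -> regular_at x f -> regular_at x g;
  regular_neq0 : forall x f, regular_at x f -> f x != 0 ->
    exists U, [/\ is_open U, U x & forall y, U y -> f y != 0];
  regular_const : forall x c, regular_at x (fun _ => c);
  regularD : forall x f g, regular_at x f -> regular_at x g ->
    regular_at x (fun y => f y + g y);
  regularM : forall x f g, regular_at x f -> regular_at x g ->
    regular_at x (fun y => f y * g y);
  regularV : forall x f, regular_at x f -> f x != 0 ->
    regular_at x (fun y => (f y)^-1)
}.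

Arguments is_open {K s} U.
Arguments regular_at {K s} x f.

(* All the spaces below are locally described by fractions g / h:
   [fr A g h] says that g and h are admissible numerator and denominator
   on the set A.  The basic open sets are the sets A `&` {h != 0}, and the
   regular functions are those locally of the form g / h.                      *)
Record fractions (K : fieldType) (T : Type) := Fractions {
  fr :> (T -> Prop) -> (T -> K) -> (T -> K) -> Prop;
  fr_const : forall c, fr (fun _ => True) (fun _ => c) (fun _ => 1);
  fr_swap : forall A g h, fr A g h -> fr A h g;
  fr_add : forall A g h A' g' h', fr A g h -> fr A' g' h' ->
    fr (fun x => A x /\ A' x)
       (fun x => g x * h' x + g' x * h x) (fun x => h x * h' x);
  fr_mul : forall A g h A' g' h', fr A g h -> fr A' g' h' ->
    fr (fun x => A x /\ A' x) (fun x => g x * g' x) (fun x => h x * h' x)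
}.

Section FractionSpace.
Context (K : fieldType) (T : Type) (E : fractions K T).
Implicit Types (x y : T) (U V A : T -> Prop) (f g h : T -> K).

Definition fr_open U : Prop :=
  forall x, U x -> exists A g h,
    [/\ E A g h, A x, h x != 0 & forall y, A y -> h y != 0 -> U y].

Definition fr_regular x f : Prop :=
  exists A g h,
    [/\ E A g h, A x, h x != 0 & forall y, A y -> h y != 0 -> f y = g y / h y].

Lemma fr_openT : fr_open (fun _ => True).
Proof.
move=> x _; exists (fun _ => True), (fun _ => 1), (fun _ => 1).
by split=> //; [exact: fr_const | rewrite oner_eq0].
Qed.

Lemma fr_openI U V :
  fr_open U -> fr_open V -> fr_open (fun x => U x /\ V x).
Proof.
move=> oU oV x [/oU[A [g [h [E1 Ax hx H]]]] /oV[A' [g' [h' [E2 A'x h'x H']]]]].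
exists (fun x => A x /\ A' x), (fun x => g x * g' x), (fun x => h x * h' x).
split=> //; [exact: fr_mul | by rewrite mulf_neq0 |].
by move=> y [Ay A'y]; rewrite mulf_eq0 negb_or => /andP[hy h'y]; split; auto.
Qed.

Lemma fr_open_locally U :
  (forall x, U x -> exists V, [/\ fr_open V, V x & forall y, V y -> U y]) ->
  fr_open U.
Proof.
move=> H x /H[V [oV /oV[A [g [h [EA Ax hx HA]]]] VU]].
by exists A, g, h; split=> // y Ay hy; apply/VU/HA.
Qed.

Lemma fr_basic A g h : E A g h -> fr_open (fun x => A x /\ h x != 0).
Proof. by move=> EA x [Ax hx]; exists A, g, h; split. Qed.

Lemma fr_regular_near x f : fr_regular x f ->
  exists U, [/\ fr_open U, U x & forall y, U y -> fr_regular y f].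
Proof.
move=> [A [g [h [EA Ax hx H]]]]; exists (fun x => A x /\ h x != 0).
by split=> //; [exact: fr_basic EA | move=> y [Ay hy]; exists A, g, h].
Qed.

Lemma fr_restrict A g h A' g' h' : E A g h -> E A' g' h' ->
  exists B k l, [/\ E B k l, forall x, B x <-> A x /\ A' x,
    forall x, k x = g x * h' x & forall x, l x = h x * h' x].
Proof.
move=> E1 E2.
have E0 := fr_add (fr_mul E2 (fr_const E 0)) (fr_const E 1).
do 3 eexists; split; [exact: fr_mul E1 E0 | | |] => x /=; first by tauto.
  by rewrite mulr0 mul0r add0r mul1r mulr1.
by rewrite !mulr1.
Qed.

Lemma fr_regular_local x f g U : fr_open U -> U x ->
  (forall y, U y -> f y = g y) -> fr_regular x f -> fr_regular x g.
Proof.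
move=> oU /oU[A [a [b [EA Ax bx H]]]] fg [A' [c [d [EA' A'x dx H']]]].
have [B [k [l [EB eB ek el]]]] := fr_restrict EA' EA.
exists B, k, l; split=> //; first exact/eB.
  by rewrite el mulf_neq0.
move=> y /eB[A'y Ay]; rewrite ek el mulf_eq0 negb_or => /andP[dy byn0].
by rewrite -mulf_div divff // mulr1 -fg ?H' //; apply: H.
Qed.

Lemma fr_regular_neq0 x f : fr_regular x f -> f x != 0 ->
  exists U, [/\ fr_open U, U x & forall y, U y -> f y != 0].
Proof.
move=> [A [g [h [EA Ax hx H]]]] fx.
exists (fun y => (A y /\ g y != 0) /\ (A y /\ h y != 0)); split.
- by apply: fr_openI; [apply: fr_basic (fr_swap EA) | apply: fr_basic EA].
- split; split=> //; apply: contraNneq fx => gx.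
  by rewrite (H x) // gx mul0r.
- by move=> y [[Ay gy] [_ hy]]; rewrite H // mulf_neq0 // invr_eq0.
Qed.

Lemma fr_regular_const x c : fr_regular x (fun _ => c).
Proof.
exists (fun _ => True), (fun _ => c), (fun _ => 1); split=> //.
- exact: fr_const.
- by rewrite oner_eq0.
- by move=> y _ _; rewrite divr1.
Qed.

Lemma fr_regularD x f g : fr_regular x f -> fr_regular x g ->
  fr_regular x (fun y => f y + g y).
Proof.
move=> [A [a [b [E1 Ax bx H]]]] [A' [c [d [E2 A'x dx H']]]].
do 3 eexists; split; [exact: fr_add E1 E2 | by [] | by rewrite mulf_neq0 |].
move=> y [Ay A'y]; rewrite mulf_eq0 negb_or => /andP[byn0 dy].
by rewrite H // H' // addf_div.
Qed.

Lemma fr_regularM x f g : fr_regular x f -> fr_regular x g ->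
  fr_regular x (fun y => f y * g y).
Proof.
move=> [A [a [b [E1 Ax bx H]]]] [A' [c [d [E2 A'x dx H']]]].
do 3 eexists; split; [exact: fr_mul E1 E2 | by [] | by rewrite mulf_neq0 |].
move=> y [Ay A'y]; rewrite mulf_eq0 negb_or => /andP[byn0 dy].
by rewrite H // H' // mulf_div.
Qed.

Lemma fr_regularV x f : fr_regular x f -> f x != 0 ->
  fr_regular x (fun y => (f y)^-1).
Proof.
move=> rf fx; have [U [oU Ux HU]] := fr_regular_neq0 rf fx.
have [A [g [h [EA Ax hx H]]]] := rf.
apply: (@fr_regular_local x (fun y => h y / g y) _ _ (fr_basic EA)) => //.
  by move=> y [Ay hy]; rewrite H // invf_div.
exists A, h, g; split=> //; first exact: fr_swap.
by apply: contraNneq fx => gx; rewrite (H x) // gx mul0r.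
Qed.

Definition fr_space : space K :=
  Space fr_openT fr_openI fr_open_locally fr_regular_near fr_regular_local
    fr_regular_neq0 fr_regular_const fr_regularD fr_regularM fr_regularV.

End FractionSpace.

(* The underlying variety of the additive group (K, +): the affine line. *)
Section AffineLine.
Context (K : fieldType).

Definition line_fr (A : K -> Prop) (g h : K -> K) : Prop :=
  exists p q : {poly K},
    [/\ forall t, A t, forall t, g t = p.[t] & forall t, h t = q.[t]].

Lemma line_fr_const c : line_fr (fun _ => True) (fun _ => c) (fun _ => 1).
Proof. by exists c%:P, 1; split=> // t; rewrite hornerC. Qed.

Lemma line_fr_swap A g h : line_fr A g h -> line_fr A h g.
Proof. by move=> [p [q [? ? ?]]]; exists q, p. Qed.

Lemma line_fr_add A g h A' g' h' : line_fr A g h -> line_fr A' g' h' ->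
  line_fr (fun x => A x /\ A' x)
     (fun x => g x * h' x + g' x * h x) (fun x => h x * h' x).
Proof.
move=> [p [q [? eg eh]]] [p' [q' [? eg' eh']]].
by exists (p * q' + p' * q), (q * q'); split=> // t; rewrite !hornerE ?eg ?eh ?eg' ?eh'.
Qed.

Lemma line_fr_mul A g h A' g' h' : line_fr A g h -> line_fr A' g' h' ->
  line_fr (fun x => A x /\ A' x) (fun x => g x * g' x) (fun x => h x * h' x).
Proof.
move=> [p [q [? eg eh]]] [p' [q' [? eg' eh']]].
by exists (p * p'), (q * q'); split=> // t; rewrite !hornerE ?eg ?eh ?eg' ?eh'.
Qed.

Definition affine_line : space K :=
  fr_space (Fractions line_fr_const line_fr_swap line_fr_add line_fr_mul).

End AffineLine.

(* P^n is the set of lines through 0 in K^(n+1).  A form is evaluated at a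
   point through the chosen nonzero vector [vpick] of the line; whether a form
   vanishes, and the quotient of two forms of the same degree, do not depend on
   that choice.                                                                *)
Section ProjectiveSpace.
Context (K : fieldType) (n : nat).

Definition proj_point : Type := {L : {vspace 'rV[K]_n.+1} | \dim L == 1%N}.

Definition form_eval (F : {mpoly K[n.+1]}) (y : proj_point) : K :=
  F.@[fun i => vpick (val y) 0 i].

Definition proj_fr (A : proj_point -> Prop) (g h : proj_point -> K) : Prop :=
  exists d (F G : {mpoly K[n.+1]}),
    [/\ F \is d.-homog, G \is d.-homog, forall y, A y,
        forall y, g y = form_eval F y & forall y, h y = form_eval G y].

Lemma proj_fr_const c : proj_fr (fun _ => True) (fun _ => c) (fun _ => 1).
Proof.
exists 0%N, c%:MP, 1; split=> //; rewrite ?dhomog1 //.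
- by rewrite -[c%:MP]mulr1 mul_mpolyC; apply/dhomogZ/dhomog1.
- by move=> y; rewrite /form_eval mevalC.
- by move=> y; rewrite /form_eval meval1.
Qed.

Lemma proj_fr_swap A g h : proj_fr A g h -> proj_fr A h g.
Proof. by move=> [d [F [G [? ? ? ? ?]]]]; exists d, G, F. Qed.

Lemma proj_fr_add A g h A' g' h' : proj_fr A g h -> proj_fr A' g' h' ->
  proj_fr (fun x => A x /\ A' x)
     (fun x => g x * h' x + g' x * h x) (fun x => h x * h' x).
Proof.
move=> [d [F [G [hF hG ? eg eh]]]] [d' [F' [G' [hF' hG' ? eg' eh']]]].
exists (d + d')%N, (F * G' + F' * G), (G * G'); split=> //.
- by apply: dhomogD; [|rewrite addnC]; apply: dhomogM.
- exact: dhomogM.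
- by move=> y; rewrite /form_eval mevalD !mevalM eg eh eg' eh'.
- by move=> y; rewrite /form_eval mevalM eh eh'.
Qed.

Lemma proj_fr_mul A g h A' g' h' : proj_fr A g h -> proj_fr A' g' h' ->
  proj_fr (fun x => A x /\ A' x) (fun x => g x * g' x) (fun x => h x * h' x).
Proof.
move=> [d [F [G [hF hG ? eg eh]]]] [d' [F' [G' [hF' hG' ? eg' eh']]]].
exists (d + d')%N, (F * F'), (G * G'); split=> //; try exact: dhomogM.
- by move=> y; rewrite /form_eval mevalM eg eg'.
- by move=> y; rewrite /form_eval mevalM eh eh'.
Qed.

Definition proj_space : space K :=
  fr_space (Fractions proj_fr_const proj_fr_swap proj_fr_add proj_fr_mul).

End ProjectiveSpace.

(* A subset with the induced topology and sheaf of functions. *)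
Section Subspace.
Context (K : fieldType) (S : space K) (A : pred S).

Definition sub_open (U : {x : S | A x} -> Prop) : Prop :=
  exists V, is_open V /\ forall x, U x <-> V (val x).

Definition sub_regular (x : {x : S | A x}) (f : {x : S | A x} -> K) : Prop :=
  exists V g, [/\ is_open V, V (val x), regular_at (val x) g &
    forall y, V (val y) -> f y = g (val y)].

Lemma sub_openT : sub_open (fun _ => True).
Proof. by exists (fun _ => True); split=> //; apply: openT. Qed.

Lemma sub_openI U V :
  sub_open U -> sub_open V -> sub_open (fun x => U x /\ V x).
Proof.
move=> [U' [oU eU]] [V' [oV eV]]; exists (fun x => U' x /\ V' x).
by split=> [|x]; [apply: openI | rewrite eU eV].
Qed.

Lemma sub_open_locally U :
  (forall x, U x -> exists V, [/\ sub_open V, V x & forall y, V y -> U y]) ->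
  sub_open U.
Proof.
move=> H; exists (fun s => exists V, [/\ is_open V, V s &
  forall y : {x : S | A x}, V (val y) -> U y]); split.
  apply: open_locally => s [V [oV Vs VU]]; exists V.
  by split=> // s' Vs'; exists V.
move=> x; split=> [/H[V [[V' [oV' eV] Vx VU]]]|[V [oV Vx VU]]]; last exact: VU.
by exists V'; split=> //; [apply/eV | move=> y /eV/VU].
Qed.

Lemma sub_open_val V : is_open V -> sub_open (fun x => V (val x)).
Proof. by exists V. Qed.

Lemma sub_regular_near x f : sub_regular x f ->
  exists U, [/\ sub_open U, U x & forall y, U y -> sub_regular y f].
Proof.
move=> [V [g [oV Vx rg H]]]; have [U [oU Ux HU]] := regular_near rg.
exists (fun y => V (val y) /\ U (val y)); split=> //.
  exact: (sub_open_val (openI oV oU)).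
by move=> y [Vy Uy]; exists V, g; split=> //; apply: HU.
Qed.

Lemma sub_regular_local x f g U : sub_open U -> U x ->
  (forall y, U y -> f y = g y) -> sub_regular x f -> sub_regular x g.
Proof.
move=> [U' [oU' eU]] /eU U'x fg [V [k [oV Vx rk H]]].
exists (fun y => V y /\ U' y), k; split=> //; first exact: openI.
by move=> y [Vy U'y]; rewrite -fg ?H //; apply/eU.
Qed.

Lemma sub_regular_neq0 x f : sub_regular x f -> f x != 0 ->
  exists U, [/\ sub_open U, U x & forall y, U y -> f y != 0].
Proof.
move=> [V [g [oV Vx rg H]]]; rewrite H // => gx.
have [U [oU Ux HU]] := regular_neq0 rg gx.
exists (fun y => V (val y) /\ U (val y)); split=> //.
  exact: (sub_open_val (openI oV oU)).
by move=> y [Vy Uy]; rewrite H //; apply: HU.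
Qed.

Lemma sub_regular_const x c : sub_regular x (fun _ => c).
Proof.
exists (fun _ => True), (fun _ => c).
by split=> //; [apply: openT | apply: regular_const].
Qed.

Lemma sub_regularD x f g : sub_regular x f -> sub_regular x g ->
  sub_regular x (fun y => f y + g y).
Proof.
move=> [V [a [oV Vx ra H]]] [V' [b [oV' V'x rb H']]].
exists (fun y => V y /\ V' y), (fun y => a y + b y); split=> //.
- exact: openI.
- exact: regularD.
- by move=> y [Vy V'y]; rewrite H // H'.
Qed.

Lemma sub_regularM x f g : sub_regular x f -> sub_regular x g ->
  sub_regular x (fun y => f y * g y).
Proof.
move=> [V [a [oV Vx ra H]]] [V' [b [oV' V'x rb H']]].
exists (fun y => V y /\ V' y), (fun y => a y * b y); split=> //.
- exact: openI.
- exact: regularM.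
- by move=> y [Vy V'y]; rewrite H // H'.
Qed.

Lemma sub_regularV x f : sub_regular x f -> f x != 0 ->
  sub_regular x (fun y => (f y)^-1).
Proof.
move=> [V [a [oV Vx ra H]]]; rewrite H // => ax.
exists V, (fun y => (a y)^-1); split=> //; first exact: regularV.
by move=> y Vy; rewrite H.
Qed.

Definition subspace : space K :=
  Space sub_openT sub_openI sub_open_locally sub_regular_near sub_regular_local
    sub_regular_neq0 sub_regular_const sub_regularD sub_regularM sub_regularV.

End Subspace.

(* The product of varieties: numerators and denominators on an open box U x V
   are the finite sums \sum_i a_i(x) b_i(y), a_i regular on U, b_i on V.       *)
Section Product.
Context (K : fieldType) (S T : space K).

Definition prod_section (U : S -> Prop) (V : T -> Prop) (g : S * T -> K) :=
  exists (I : finType) (a : I -> S -> K) (b : I -> T -> K),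
    [/\ forall i x, U x -> regular_at x (a i),
        forall i y, V y -> regular_at y (b i) &
        forall x y, U x -> V y -> g (x, y) = \sum_i a i x * b i y].

Definition prod_fr (A : S * T -> Prop) (g h : S * T -> K) : Prop :=
  exists U V, [/\ is_open U, is_open V, forall p, A p <-> U p.1 /\ V p.2,
    prod_section U V g & prod_section U V h].

Lemma prod_sectionS (U U' : S -> Prop) (V V' : T -> Prop) g :
  (forall x, U' x -> U x) -> (forall y, V' y -> V y) ->
  prod_section U V g -> prod_section U' V' g.
Proof.
move=> sU sV [I [a [b [ra rb e]]]]; exists I, a, b.
by split=> [i x /sU|i y /sV|x y /sU + /sV]; auto.
Qed.

Lemma prod_section_const U V c : prod_section U V (fun _ => c).
Proof.
exists unit, (fun _ _ => c), (fun _ _ => 1).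
split=> [? ? _|? ? _|? ? _ _]; try exact: regular_const.
by rewrite (big_pred1 tt) ?mulr1 // => -[].
Qed.

Lemma prod_sectionD U V g h : prod_section U V g -> prod_section U V h ->
  prod_section U V (fun p => g p + h p).
Proof.
move=> [I [a [b [ra rb e]]]] [J [a' [b' [ra' rb' e']]]].
exists (I + J)%type.
exists (fun k => match k with inl i => a i | inr j => a' j end).
exists (fun k => match k with inl i => b i | inr j => b' j end).
split=> [[i|j]|[i|j]|x y Ux Vy]; auto.
by rewrite big_sumType /= e // e'.
Qed.

Lemma prod_sectionM U V g h : prod_section U V g -> prod_section U V h ->
  prod_section U V (fun p => g p * h p).
Proof.
move=> [I [a [b [ra rb e]]]] [J [a' [b' [ra' rb' e']]]].
exists (I * J)%type, (fun k x => a k.1 x * a' k.2 x).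
exists (fun k y => b k.1 y * b' k.2 y).
split=> [k x Ux|k y Vy|x y Ux Vy].
- by apply: regularM; auto.
- by apply: regularM; auto.
rewrite e // e' // big_distrlr /= pair_bigA /=.
by apply: eq_bigr => k _; rewrite mulrACA.
Qed.

Lemma prod_fr_const c : prod_fr (fun _ => True) (fun _ => c) (fun _ => 1).
Proof.
exists (fun _ => True), (fun _ => True).
by split=> //; do ?[exact: openT | exact: prod_section_const].
Qed.

Lemma prod_fr_swap A g h : prod_fr A g h -> prod_fr A h g.
Proof. by move=> [U [V [? ? ? ? ?]]]; exists U, V. Qed.

Lemma prod_fr_common A g h A' g' h' : prod_fr A g h -> prod_fr A' g' h' ->
  exists U V, [/\ is_open U, is_open V,
    forall p, A p /\ A' p <-> U p.1 /\ V p.2,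
    prod_section U V g /\ prod_section U V h &
    prod_section U V g' /\ prod_section U V h'].
Proof.
move=> [U [V [oU oV eA sg sh]]] [U' [V' [oU' oV' eA' sg' sh']]].
exists (fun x => U x /\ U' x), (fun x => V x /\ V' x); split.
- exact: openI.
- exact: openI.
- by move=> p; rewrite eA eA'; tauto.
- by split; [move: sg | move: sh]; apply: prod_sectionS => ? [].
- by split; [move: sg' | move: sh']; apply: prod_sectionS => ? [].
Qed.

Lemma prod_fr_add A g h A' g' h' : prod_fr A g h -> prod_fr A' g' h' ->
  prod_fr (fun x => A x /\ A' x)
     (fun x => g x * h' x + g' x * h x) (fun x => h x * h' x).
Proof.
move=> E1 /(prod_fr_common E1)[U [V [oU oV eA [sg sh] [sg' sh']]]].
exists U, V; split=> //; last exact: prod_sectionM.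
by apply: prod_sectionD; apply: prod_sectionM.
Qed.

Lemma prod_fr_mul A g h A' g' h' : prod_fr A g h -> prod_fr A' g' h' ->
  prod_fr (fun x => A x /\ A' x) (fun x => g x * g' x) (fun x => h x * h' x).
Proof.
move=> E1 /(prod_fr_common E1)[U [V [oU oV eA [sg sh] [sg' sh']]]].
by exists U, V; split=> //; apply: prod_sectionM.
Qed.

Definition prod_space : space K :=
  fr_space (Fractions prod_fr_const prod_fr_swap prod_fr_add prod_fr_mul).

End Product.

Section Geometry.
Context (K : fieldType).

Definition morphism (S T : space K) (phi : S -> T) : Prop :=
  (forall U, is_open U -> is_open (fun x => U (phi x))) /\
  (forall x f, regular_at (phi x) f -> regular_at x (fun y => f (phi y))).

(* Krull dimension of the underlying topological space. *)
Definition is_closed (S : space K) (Z : S -> Prop) : Prop :=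
  is_open (fun x => ~ Z x).

Definition irreducible (S : space K) (Z : S -> Prop) : Prop :=
  (exists x, Z x) /\
  forall Z1 Z2, is_closed Z1 -> is_closed Z2 ->
    (forall x, Z x -> Z1 x \/ Z2 x) ->
    (forall x, Z x -> Z1 x) \/ (forall x, Z x -> Z2 x).

Definition irreducible_chain (S : space K) (m : nat) (Z : nat -> S -> Prop) :=
  (forall i, (i <= m)%N -> is_closed (Z i) /\ irreducible (Z i)) /\
  (forall i, (i < m)%N -> (forall x, Z i x -> Z i.+1 x) /\
                          (exists x, Z i.+1 x /\ ~ Z i x)).

Definition has_dim (S : space K) (d : nat) : Prop :=
  (exists Z, @irreducible_chain S d Z) /\
  (forall m Z, @irreducible_chain S m Z -> (m <= d)%N).

(* Tangent vectors at y are the K-linear point derivations of the local ring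
   at y, with two of them identified when they agree on all germs ([tan_eq]);
   their values on functions that are not regular at y are irrelevant.         *)
Definition is_tangent (S : space K) (y : S) (D : (S -> K) -> K) : Prop :=
  [/\ forall f g U, is_open U -> U y -> (forall x, U x -> f x = g x) ->
        regular_at y f -> D f = D g,
      forall f g, regular_at y f -> regular_at y g ->
        D (fun x => f x + g x) = D f + D g,
      forall c f, regular_at y f -> D (fun x => c * f x) = c * D f &
      forall f g, regular_at y f -> regular_at y g ->
        D (fun x => f x * g x) = f y * D g + g y * D f].

Definition tan_eq (S : space K) (y : S) (D D' : (S -> K) -> K) : Prop :=
  forall f, regular_at y f -> D f = D' f.

Definition tan_comb (S : space K) m (c : 'I_m -> K)
    (v : 'I_m -> (S -> K) -> K) : (S -> K) -> K :=
  fun f => \sum_(i < m) c i * v i f.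

Definition tangent_dim (S : space K) (y : S) (d : nat) : Prop :=
  exists v : 'I_d -> (S -> K) -> K,
    [/\ forall i, is_tangent y (v i),
        forall c, tan_eq y (tan_comb c v) (fun _ => 0) -> forall i, c i = 0 &
        forall D, is_tangent y D -> exists c, tan_eq y D (tan_comb c v)].

(* This is smoothness on an irreducible S, where all local dimensions agree. *)
Definition smooth_at (S : space K) (y : S) : Prop :=
  exists d, has_dim S d /\ tangent_dim y d.

Definition tangent_spanned (S : space K) (y : S)
    (P : ((S -> K) -> K) -> Prop) : Prop :=
  forall D, is_tangent y D ->
    exists m (c : 'I_m -> K) (v : 'I_m -> (S -> K) -> K),
      (forall i, P (v i)) /\ tan_eq y D (tan_comb c v).

Definition Ga_action (S : space K) (a : K -> S -> S) : Prop :=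
  [/\ @morphism (prod_space (affine_line K) S) S (fun p => a p.1 p.2),
      forall y, a 0 y = y &
      forall s t y, a (s + t) y = a s (a t y)].

Definition effective (S : space K) (a : K -> S -> S) : Prop :=
  forall t, (forall y, a t y = y) -> t = 0.

(* The image of T_0(Ga) under the differential at 0 of t |-> a t y. *)
Definition orbit_tangent (S : space K) (a : K -> S -> S) (y : S)
    (D : (S -> K) -> K) : Prop :=
  exists v : (K -> K) -> K, @is_tangent (affine_line K) 0 v /\
    tan_eq y D (fun f => v (fun t => f (a t y))).

Definition flexible_at (S : space K) (y : S) : Prop :=
  tangent_spanned y (fun D =>
    exists a, [/\ Ga_action a, effective a & orbit_tangent a y D]).

Definition flexible (S : space K) : Prop :=
  forall y : S, smooth_at y -> flexible_at y.

End Geometry.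

Section Quadric.
Context (K : fieldType) (n : nat).

Definition quadric (q : {mpoly K[n.+1]}) : pred (proj_space K n) :=
  fun y => form_eval q y == 0.

(* The symmetric matrix of a quadratic form, by polarization at the basis
   vectors; for a 2-homogeneous q in characteristic not 2, q(x) = x A x^T.     *)
Definition qform_mx (q : {mpoly K[n.+1]}) : 'M[K]_n.+1 :=
  let e (i : 'I_n.+1) : 'I_n.+1 -> K := fun k => (k == i)%:R in
  \matrix_(i, j)
    ((q.@[fun k => e i k + e j k] - q.@[e i] - q.@[e j]) / 2%:R).

Definition qform_rank (q : {mpoly K[n.+1]}) : nat := \rank (qform_mx q).

End Quadric.

(* Main.v *)
(* Let b be the bilinear form of q and let x be a vector on the line y, so that
   b(x,x) <> 0.  For every isotropic u orthogonal to x, the endomorphism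
   N v = b(u,v) x - b(x,v) u is skew for b and N^3 = 0; thus t |-> exp (t N)
   acts on Y by isometries of q, and its orbit through y has velocity
   -b(x,x) u in T_y Y = x^perp.  Since q has rank at least 3, every w in x^perp
   with b(w,w) <> 0 has a nonisotropic e orthogonal to both x and w, and after
   rescaling e by a square root w is half the sum of the isotropic vectors
   w + e and w - e; so the isotropic vectors span x^perp.                     *)

Require Import Defs.
From mathcomp Require Import all_boot all_order all_algebra.
From mathcomp Require Import mpoly ring.
From Stdlib Require Import ClassicalEpsilon FunctionalExtensionality.

Set Implicit Arguments.
Unset Strict Implicit.
Unset Printing Implicit Defensive.

Import GRing.Theory.
Local Open Scope ring_scope.

Local Notation space := Defs.space.

(** * Polynomials as ring expressions; scaling of homogeneous forms *)

Section Mpoly.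
Context (R : comNzRingType) (n : nat).
Implicit Types (p : {mpoly R[n]}) (P : {mpoly R[n]} -> Prop).

(** Passes from the variables to all polynomial expressions for any property stable under ring
    operations: regularity, agreement of derivations, being a section on a product box. *)
Lemma mpoly_ring_ind P :
  (forall c, P c%:MP) -> (forall i, P 'X_i) ->
  (forall p q, P p -> P q -> P (p + q)) ->
  (forall p q, P p -> P q -> P (p * q)) -> forall p, P p.
Proof.
move=> PC PX PD PM p; rewrite (mpolyE p).
elim/big_ind: _ => [||m _]; [by rewrite -mpolyC0 | exact: PD |].
rewrite -mul_mpolyC mpolyXE_id; apply: (PM) => //.
elim/big_ind: _ => [||i _]; [by rewrite -mpolyC1 | exact: PM |].
elim: (m i) => [|k IHk]; first by rewrite expr0 -mpolyC1.
by rewrite exprS; apply: PM.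
Qed.

Lemma meval_homogZ d p (c : R) (x : 'I_n -> R) : p \is d.-homog ->
  p.@[fun i => c * x i] = c ^+ d * p.@[x].
Proof.
move=> /dhomogP hp; rewrite !mevalE big_distrr /=.
apply: eq_big_seq => m /hp <- /=.
rewrite mdegE -prodrXr mulrCA -big_split /=; congr (_ * _).
by apply: eq_bigr => i _; rewrite exprMn.
Qed.

End Mpoly.

(** * Bilinear forms and isotropic vectors *)

Section Bilinear.
Context (K : fieldType) (n : nat) (B : 'M[K]_n).
Implicit Types (x y z : 'rV[K]_n).

Definition bil x y : K := (x *m B *m y^T) 0 0.

Lemma bilDl x y z : bil (x + y) z = bil x z + bil y z.
Proof. by rewrite /bil !mulmxDl mxE. Qed.

Lemma bilDr x y z : bil z (x + y) = bil z x + bil z y.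
Proof. by rewrite /bil linearD mulmxDr mxE. Qed.

Lemma bilZl c x y : bil (c *: x) y = c * bil x y.
Proof. by rewrite /bil -!scalemxAl mxE. Qed.

Lemma bilZr c x y : bil x (c *: y) = c * bil x y.
Proof. by rewrite /bil linearZ /= -scalemxAr mxE. Qed.

Lemma bil0l x : bil 0 x = 0.
Proof. by rewrite /bil !mul0mx mxE. Qed.

Lemma bil0r x : bil x 0 = 0.
Proof. by rewrite /bil trmx0 mulmx0 mxE. Qed.

Lemma bilNr x y : bil x (- y) = - bil x y.
Proof. by rewrite -scaleN1r bilZr mulN1r. Qed.

Lemma bilE x y : bil x y = \sum_j (x *m B) 0 j * y 0 j.
Proof. by rewrite /bil mxE; apply: eq_bigr => j _; rewrite !mxE. Qed.

(** [pr] is the orthogonal projection onto the complement of x and w. If two projected basis vectors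
    e, f have nonzero product, then one of e, f, e + f is nonisotropic, because b(e + f, e + f) = 2
    b(e, f) when e and f are isotropic. *)
Lemma bil_rank3 : (2 < \rank B)%N -> (forall x y, bil x y = bil y x) ->
  2%:R != 0 :> K ->
  forall x w, bil x w = 0 -> bil x x != 0 -> bil w w != 0 ->
  exists e, [/\ bil x e = 0, bil w e = 0 & bil e e != 0].
Proof.
move=> rkB sym two_neq0 x w xw xx ww.
pose pr y := y - (bil x y / bil x x) *: x - (bil w y / bil w w) *: w.
have xpr y : bil x (pr y) = 0.
  by rewrite /pr !bilDr -!scaleNr !bilZr xw mulr0 addr0 mulNr divfK ?subrr.
have wpr y : bil w (pr y) = 0.
  rewrite /pr !bilDr -!scaleNr !bilZr [bil w x]sym xw mulr0 addr0 mulNr.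
  by rewrite divfK ?subrr.
case: (pickP (fun ij : 'I_n * 'I_n =>
  bil (pr (delta_mx 0 ij.1)) (pr (delta_mx 0 ij.2)) != 0)) => [[i j] /= nz|nz].
  pose e := pr (delta_mx 0 i); pose f := pr (delta_mx 0 j).
  case: (eqVneq (bil e e) 0) => [ee|]; last first.
    by exists e; split; [exact: xpr | exact: wpr |].
  case: (eqVneq (bil f f) 0) => [ff|]; last first.
    by exists f; split; [exact: xpr | exact: wpr |].
  have [xe we] : bil x e = 0 /\ bil w e = 0 by split; [exact: xpr | exact: wpr].
  have [xf wf] : bil x f = 0 /\ bil w f = 0 by split; [exact: xpr | exact: wpr].
  rewrite -/e -/f in nz; clearbody e f; exists (e + f).
  rewrite !bilDr xe xf we wf !addr0; split=> //.
  rewrite !bilDl ee ff add0r addr0 [bil f e]sym -mulr2n -mulr_natl.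
  by rewrite mulf_neq0.
(* Otherwise b vanishes on {x, w}^perp, and B has rank at most 2. *)
suff eB : B = (bil x x)^-1 *: ((x *m B)^T *m (x *m B))
            + (bil w w)^-1 *: ((w *m B)^T *m (w *m B)).
  move: rkB; rewrite ltnNge eB => /negP[].
  apply: leq_trans (mxrank_add _ _) _; rewrite -[2%N]/(1 + 1)%N.
  by apply: leq_add; apply: leq_trans (mxrank_scale _ _) _;
     apply: leq_trans (mxrankM_maxr _ _) _; apply: rank_leq_row.
have bd y i : bil y (delta_mx 0 i) = (y *m B) 0 i.
  rewrite bilE (bigD1 i) //= big1 ?addr0.
    by rewrite [delta_mx _ _ _ _]mxE !eqxx mulr1.
  move=> j ji.
  by rewrite [delta_mx _ _ _ _]mxE (negPf ji) andbF mulr0.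
apply/matrixP => i j.
have /negbFE/eqP := nz (i, j).
rewrite /= [in X in bil X _]/pr !bilDl -!scaleNr !bilZl xpr wpr !mulr0 !addr0.
rewrite /pr !bilDr -!scaleNr !bilZr [bil (delta_mx _ _) x]sym.
rewrite [bil (delta_mx _ _) w]sym !bd -rowE.
rewrite [row i B 0 j]mxE -addrA => /eqP; rewrite addr_eq0 => /eqP ->.
rewrite !mxE !big_ord1 !mxE; ring.
Qed.

End Bilinear.

Lemma sqrt_exists (K : closedFieldType) (a : K) : exists c, c ^+ 2 = a.
Proof.
have [c ec] := @solve_monicpoly K 2 (fun i => if i == 0%N then a else 0) isT.
by exists c; rewrite ec !big_ord_recl big_ord0 /= mul0r !addr0 expr0 mulr1.
Qed.

Lemma isotropic_sum (K : closedFieldType) n (B : 'M[K]_n) x d :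
  (2 < \rank B)%N -> (forall y z, bil B y z = bil B z y) -> 2%:R != 0 :> K ->
  bil B x x != 0 -> bil B x d = 0 -> d != 0 ->
  exists u v, [/\ d = u + v,
    [/\ u != 0, bil B x u = 0 & bil B u u = 0] &
    [/\ v != 0, bil B x v = 0 & bil B v v = 0]].
Proof.
move=> rkB sym two xx xd d_neq0.
have half : 2%:R^-1 + 2%:R^-1 = 1 :> K by field.
case: (eqVneq (bil B d d) 0) => [dd|dd].
  (* An isotropic d is split into two equal halves. *)
  exists (2%:R^-1 *: d), (2%:R^-1 *: d).
  rewrite -scalerDl half scale1r scaler_eq0 invr_eq0 (negPf two) (negPf d_neq0).
  by rewrite !bilZr !bilZl dd xd !mulr0.
have [e [xe de ee]] := bil_rank3 rkB sym two xd xx dd.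
have [c cc] := sqrt_exists (- bil B d d / bil B e e).
(* The sign s is 1 or -1; since d and e are orthogonal and c^2 b(e,e) = - b(d,d), both choices are
   isotropic. *)
pose u (s : K) := 2%:R^-1 *: (d + (s * c) *: e).
have uP s : s ^+ 2 = 1 ->
    [/\ u s != 0, bil B x (u s) = 0 & bil B (u s) (u s) = 0].
  move=> ss; split.
  (* Pairing with d gives b(d, u s) = b(d,d) / 2, which is nonzero. *)
  - apply: contraNneq dd => u0; have := bil0r B d.
    rewrite -u0 bilZr bilDr bilZr de mulr0 addr0 => /eqP.
    by rewrite mulf_eq0 invr_eq0 (negPf two).
  - by rewrite bilZr bilDr bilZr xd xe mulr0 addr0 mulr0.
  - rewrite bilZr bilZl bilDr !bilDl !bilZr !bilZl [bil B e d]sym de.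
    rewrite !mulr0 addr0 add0r [s * c * _]mulrA -expr2 exprMn ss mul1r cc.
    by rewrite divfK // subrr !mulr0.
exists (u 1), (u (-1)).
split; [|apply: uP|apply: uP]; rewrite ?sqrrN ?expr1n // -scalerDr mul1r.
by rewrite mulN1r scaleNr addrACA subrr addr0 scalerDr -scalerDl half scale1r.
Qed.

(** * The symmetric matrix of a quadratic form *)

Section QuadraticForm.
Context (K : fieldType) (n : nat).
Implicit Types (p q : {mpoly K[n.+1]}) (x y z : 'rV[K]_n.+1).

Lemma qform_mx_sym q y z : bil (qform_mx q) y z = bil (qform_mx q) z y.
Proof.
have symq : (qform_mx q)^T = qform_mx q.
  apply/matrixP => i j; rewrite !mxE; congr (_ / _); rewrite addrAC.
  by congr (_ - _ - _); apply: meval_eq => k; rewrite addrC.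
transitivity ((y *m qform_mx q *m z^T)^T 0 0); first by rewrite mxE.
by rewrite !trmx_mul trmxK symq mulmxA.
Qed.

Lemma sum_delta (f : 'I_n.+1 -> K) j : \sum_k (j == k)%:R * f k = f j.
Proof.
rewrite (bigD1 j) //= eqxx mul1r big1 ?addr0 // => l /negPf.
by rewrite eq_sym => ->; rewrite mul0r.
Qed.

(** The matrix of X_i X_j is (E_ij + E_ji) / 2, also when i = j. *)
Lemma bil_qform_mxXX i j x : 2%:R != 0 :> K ->
  bil (qform_mx ('X_i * 'X_j)) x x = x 0 i * x 0 j.
Proof.
move=> two_neq0; rewrite bilE.
have eB k l : qform_mx ('X_i * 'X_j : {mpoly K[n.+1]}) k l =
    ((i == k)%:R * (j == l)%:R + (i == l)%:R * (j == k)%:R) / 2%:R.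
  by rewrite mxE !mevalM !mevalXU; congr (_ / _); ring.
have eR k : (x *m qform_mx ('X_i * 'X_j)) 0 k =
    (j == k)%:R * (x 0 i / 2%:R) + (i == k)%:R * (x 0 j / 2%:R).
  transitivity (\sum_l ((i == l)%:R * (x 0 l * (j == k)%:R / 2%:R)
                      + (j == l)%:R * (x 0 l * (i == k)%:R / 2%:R))).
    by rewrite mxE; apply: eq_bigr => l _; rewrite eB; ring.
  by rewrite big_split /= !sum_delta; ring.
transitivity (\sum_k ((j == k)%:R * (x 0 i / 2%:R * x 0 k)
                    + (i == k)%:R * (x 0 j / 2%:R * x 0 k))).
  by apply: eq_bigr => l _; rewrite eR; ring.
by rewrite big_split /= !sum_delta; field.
Qed.

Lemma bil_qform_mxD p q x :
  bil (qform_mx (p + q)) x x = bil (qform_mx p) x x + bil (qform_mx q) x x.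
Proof.
have -> : qform_mx (p + q) = qform_mx p + qform_mx q.
  by apply/matrixP => i j; rewrite !mxE !mevalD; ring.
by rewrite /bil mulmxDr mulmxDl mxE.
Qed.

Lemma bil_qform_mxZ c q x :
  bil (qform_mx (c *: q)) x x = c * bil (qform_mx q) x x.
Proof.
have -> : qform_mx (c *: q) = c *: qform_mx q.
  by apply/matrixP => i j; rewrite !mxE !mevalZ; ring.
by rewrite /bil -scalemxAr -scalemxAl mxE.
Qed.

Lemma mdeg2P (m : 'X_{1.. n.+1}) :
  mdeg m = 2%N -> exists i j, m = (U_(i) + U_(j))%MM.
Proof.
move=> m2; have [i mi] : exists i, m i != 0%N.
  apply/existsP; rewrite -negb_forall; apply: contra_eqN m2 => /forallP m0.
  by rewrite mdegE big1 // => i _; apply/eqP.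
have := submK (eq_trans (lep1mP i m) mi); rewrite addmC => em.
have /mdeg1P[j /eqP ej] : mdeg (m - U_(i))%MM == 1%N.
  by rewrite -(eqn_add2l 1) -{1}(mdeg1 i) -mdegD em m2.
by exists i, j; rewrite -ej em.
Qed.

(** Both sides are linear in q, and every monomial of degree 2 is a product of two variables. Hence
    lying off the quadric means being nonisotropic for b. *)
Lemma qform_mxE q x : 2%:R != 0 :> K -> q \is 2.-homog ->
  q.@[fun i => x 0 i] = bil (qform_mx q) x x.
Proof.
move=> two_neq0 /dhomogP hq; rewrite (mpolyE q).
rewrite !big_seq; elim/big_ind: _ => [|p1 p2 e1 e2|m /hq /= /mdeg2P[i [j ->]]].
- by rewrite meval0 -[X in qform_mx X](scale0r 0) bil_qform_mxZ mul0r.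
- by rewrite mevalD bil_qform_mxD e1 e2.
- by rewrite mpolyXD bil_qform_mxZ mevalZ mevalM !mevalXU bil_qform_mxXX.
Qed.

End QuadraticForm.

(** * The derivation d/dt at 0 on the affine line *)

Section AffineLineTangent.
Context (K : closedFieldType).
Implicit Types (p q : {poly K}) (f g : K -> K).

Lemma horner_eq0 p : (forall t, p.[t] = 0) -> p = 0.
Proof.
move=> p0; apply/eqP; apply: contraT => /closed_nonrootP[t].
by rewrite /root p0 eqxx.
Qed.

Lemma line_regular_poly t p : @regular_at K (affine_line K) t (fun s => p.[s]).
Proof.
exists (fun _ => True), (fun s => p.[s]), (fun _ => 1); split=> //.
- by exists p, 1; split=> // s; rewrite hornerC.
- by rewrite oner_eq0.
- by move=> s _ _; rewrite divr1.
Qed.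

(* f = p / q near 0, and d = f'(0) by differentiating p = f q at 0. *)
Definition line_der f (d : K) : Prop := exists p q,
  [/\ q.[0] != 0, forall t, q.[t] != 0 -> p.[t] = f t * q.[t] &
      p^`().[0] = f 0 * q^`().[0] + d * q.[0]].

(** U contains the locus r != 0 of some polynomial r with r(0) != 0; multiplying p and q by r
    confines the condition to that locus. *)
Lemma line_der_near f g d (U : affine_line K -> Prop) :
  is_open U -> U 0 -> (forall t, U t -> f t = g t) ->
  line_der f d -> line_der g d.
Proof.
move=> oU U0 fg [p [q [q0 pq dp]]].
have [A [_ [h [[_ [r [AT _ er]]] _ r0 Ur]]]] := oU 0 U0; rewrite er in r0.
have Uf t : r.[t] != 0 -> f t = g t by move=> rt; apply/fg/Ur; rewrite ?er.
exists (p * r), (q * r); split=> [|t|].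
- by rewrite hornerM mulf_neq0.
- rewrite !hornerM mulf_eq0 negb_or => /andP[qt rt].
  by rewrite pq // Uf // mulrA.
- rewrite !derivM !hornerE dp pq // Uf //=; ring.
Qed.

(** For two fractions p / q and p' / q' of f, the polynomial p q' - p' q vanishes off the zeros of q
    q', so its product with q q' is zero. Differentiating p q' = p' q at 0 then gives (d - e) q(0)
    q'(0) = 0. *)
Lemma line_der_uniq f d e : line_der f d -> line_der f e -> d = e.
Proof.
move=> [p [q [q0 pq dp]]] [p' [q' [q'0 pq' dp']]].
have /eqP : (p * q' - p' * q) * (q * q') = 0.
  apply: horner_eq0 => t; rewrite !hornerE.
  case: (eqVneq q.[t] 0) => [->|qt]; first by rewrite /=; ring.
  case: (eqVneq q'.[t] 0) => [->|q't]; first by rewrite /=; ring.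
  by rewrite pq // pq' //=; ring.
have nz (r : {poly K}) : r.[0] != 0 -> r != 0.
  by apply: contraNneq => ->; rewrite horner0.
rewrite !mulf_eq0 (negPf (nz _ q0)) (negPf (nz _ q'0)) !orbF subr_eq0 => /eqP.
move/(congr1 (fun r => r^`().[0])).
rewrite !derivM !hornerE dp dp' !pq // !pq' // => e0.
apply/eqP; rewrite -subr_eq0.
have : (d - e) * (q.[0] * q'.[0]) = 0.
  by move/eqP: e0; rewrite -subr_eq0 => /eqP e0; rewrite -[RHS]e0 /=; ring.
by move/eqP; rewrite !mulf_eq0 (negPf q0) (negPf q'0) !orbF.
Qed.

Lemma line_derC c : line_der (fun _ => c) 0.
Proof.
exists c%:P, 1; split=> [|t|]; rewrite ?hornerE ?oner_eq0 //.
by rewrite -polyC1 !derivC !hornerE.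
Qed.

Lemma line_derD f g d e : line_der f d -> line_der g e ->
  line_der (fun t => f t + g t) (d + e).
Proof.
move=> [p [q [q0 pq dp]]] [p' [q' [q'0 pq' dp']]].
exists (p * q' + p' * q), (q * q'); split=> [|t|].
- by rewrite hornerM mulf_neq0.
- rewrite !hornerE mulf_eq0 negb_or => /andP[qt q't].
  by rewrite pq // pq' //=; ring.
- by rewrite derivD !derivM !hornerE dp dp' pq // pq' //=; ring.
Qed.

Lemma line_derM f g d e : line_der f d -> line_der g e ->
  line_der (fun t => f t * g t) (f 0 * e + g 0 * d).
Proof.
move=> [p [q [q0 pq dp]]] [p' [q' [q'0 pq' dp']]].
exists (p * p'), (q * q'); split=> [|t|].
- by rewrite hornerM mulf_neq0.
- rewrite !hornerE mulf_eq0 negb_or => /andP[qt q't].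
  by rewrite pq // pq' //=; ring.
- by rewrite !derivM !hornerE dp dp' pq // pq' //=; ring.
Qed.

Lemma line_der_regular f : @regular_at K (affine_line K) 0 f ->
  exists d, line_der f d.
Proof.
move=> [A [g [h [[p [q [AT ep eq]]] _ q0 fE]]]]; rewrite eq in q0.
exists ((p^`().[0] - f 0 * q^`().[0]) / q.[0]), p, q; split=> // [t qt|].
  by rewrite fE ?ep ?eq // divfK.
by rewrite divfK // addrC subrK.
Qed.

(* Arbitrary when f is not regular at 0. *)
Definition line_d0 f : K := epsilon (inhabits 0) (line_der f).

Lemma line_d0E f d : line_der f d -> line_d0 f = d.
Proof.
move=> fd; apply: line_der_uniq (fd); rewrite /line_d0; apply: epsilon_spec.
by exists d.
Qed.

Lemma line_d0P f : @regular_at K (affine_line K) 0 f -> line_der f (line_d0 f).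
Proof. by move=> /line_der_regular; apply: epsilon_spec. Qed.

Lemma line_d0_poly p : line_d0 (fun t => p.[t]) = p^`().[0].
Proof.
apply: line_d0E; exists p, 1; split=> [|t _|]; rewrite ?hornerE ?oner_eq0 //.
by rewrite -polyC1 derivC horner0 mulr0 add0r.
Qed.

Lemma line_d0_tangent : @is_tangent K (affine_line K) 0 line_d0.
Proof.
split=> [f g U oU U0 fg|f g|c f|f g] /line_d0P rf; try move=> /line_d0P rg.
- by rewrite [RHS](line_d0E (line_der_near oU U0 fg rf)).
- exact/line_d0E/line_derD.
- have /line_d0E -> := line_derM (line_derC c) rf.
  by rewrite mulr0 addr0.
- exact/line_d0E/line_derM.
Qed.

End AffineLineTangent.

(** * Calculus of point derivations and their pushforward *)

Section Tangent.
Context (K : fieldType) (S : space K).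
Implicit Types (x : S) (f g : S -> K) (D : (S -> K) -> K).

Lemma regular_meval m (z : 'I_m -> S -> K) x (P : {mpoly K[m]}) :
  (forall i, regular_at x (z i)) ->
  regular_at x (fun y => P.@[fun i => z i y]).
Proof.
move=> rz; elim/mpoly_ring_ind: P => [c|i|P Q rP rQ|P Q rP rQ].
- apply: (regular_local (openT S)) (regular_const x c) => // y _.
  by rewrite mevalC.
- by apply: (regular_local (openT S)) (rz i) => // y _; rewrite mevalXU.
- apply: (regular_local (openT S)) (regularD rP rQ) => // y _.
  by rewrite mevalD.
- apply: (regular_local (openT S)) (regularM rP rQ) => // y _.
  by rewrite mevalM.
Qed.

(** The Leibniz rule on 1 * 1 gives D 1 = D 1 + D 1; constants follow by scaling. *)
Lemma tangent_const x D c : is_tangent x D -> D (fun _ => c) = 0.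
Proof.
move=> [Dnear _ Dscale Dmul].
have D1 : D (fun _ => 1) = 0.
  have := Dmul _ _ (regular_const x 1) (regular_const x 1).
  rewrite [in LHS](Dnear _ (fun _ => 1) _ (openT S)) //; first last.
  - exact: regularM (regular_const x 1) (regular_const x 1).
  - by move=> y _; rewrite mul1r.
  rewrite mul1r => /eqP; rewrite -{1}[D _]addr0 (can_eq (addKr _)) eq_sym.
  by move/eqP.
have := Dscale c _ (regular_const x 1).
rewrite D1 mulr0 => <-; apply: Dnear (openT S) _ _ _ => //.
- by move=> y _; rewrite mulr1.
- exact: regular_const.
Qed.

Lemma tangent_meval_eq m (z : 'I_m -> S -> K) x D D' (P : {mpoly K[m]}) :
  is_tangent x D -> is_tangent x D' ->
  (forall i, regular_at x (z i)) -> (forall i, D (z i) = D' (z i)) ->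
  D (fun y => P.@[fun i => z i y]) = D' (fun y => P.@[fun i => z i y]).
Proof.
move=> tD tD' rz Dz; elim/mpoly_ring_ind: P => [c|i|P Q eP eQ|P Q eP eQ].
- have -> : (fun y => (c%:MP_[m]).@[fun i => z i y]) = fun _ => c.
    by apply: functional_extensionality => y; rewrite mevalC.
  by rewrite (tangent_const _ tD) (tangent_const _ tD').
- suff -> : (fun y => ('X_i).@[fun i => z i y]) = z i by [].
  by apply: functional_extensionality => y; rewrite mevalXU.
- have -> : (fun y => (P + Q).@[fun i => z i y]) =
      fun y => P.@[fun i => z i y] + Q.@[fun i => z i y].
    by apply: functional_extensionality => y; rewrite mevalD.
  have [[_ addD _ _] [_ addD' _ _]] := (tD, tD').
  have [rP rQ] := (regular_meval P rz, regular_meval Q rz).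
  by rewrite addD // addD' // eP eQ.
- have -> : (fun y => (P * Q).@[fun i => z i y]) =
      fun y => P.@[fun i => z i y] * Q.@[fun i => z i y].
    by apply: functional_extensionality => y; rewrite mevalM.
  have [[_ _ _ mulD] [_ _ _ mulD']] := (tD, tD').
  have [rP rQ] := (regular_meval P rz, regular_meval Q rz).
  by rewrite mulD // mulD' // eP eQ.
Qed.

Lemma tangent_quotient x D f g h (U : S -> Prop) : is_tangent x D ->
  is_open U -> U x -> (forall y, U y -> f y * h y = g y) ->
  regular_at x f -> regular_at x h -> h x != 0 ->
  D f = (D g - f x * D h) / h x.
Proof.
move=> [Dnear _ _ Dmul] oU Ux fhg rf rh hx.
rewrite -(Dnear _ g U oU Ux fhg (regularM rf rh)) Dmul // addrAC subrr add0r.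
by rewrite mulrC mulKf.
Qed.

Lemma regular_sum (I : Type) (r : seq I) (F : I -> S -> K) x :
  (forall i, regular_at x (F i)) -> regular_at x (fun y => \sum_(i <- r) F i y).
Proof.
move=> rF; elim: r => [|i r IHr].
  apply: (regular_local (openT S)) (regular_const x 0) => // y _.
  by rewrite big_nil.
apply: (regular_local (openT S)) (regularD (rF i) IHr) => // y _.
by rewrite big_cons.
Qed.

Lemma tangent_sum (I : Type) (r : seq I) (F : I -> S -> K) x D :
  is_tangent x D -> (forall i, regular_at x (F i)) ->
  D (fun y => \sum_(i <- r) F i y) = \sum_(i <- r) D (F i).
Proof.
move=> tD rF; elim: r => [|i r IHr].
  rewrite [RHS]big_nil -[RHS](tangent_const 0 tD); congr (D _).
  by apply: functional_extensionality => y; rewrite big_nil.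
rewrite big_cons -IHr; have [_ addD _ _] := tD.
rewrite -addD //; last exact: regular_sum.
by congr (D _); apply: functional_extensionality => y; rewrite big_cons.
Qed.

Lemma tan_comb_tangent m (c : 'I_m -> K) (v : 'I_m -> (S -> K) -> K) x :
  (forall i, is_tangent x (v i)) -> is_tangent x (tan_comb c v).
Proof.
move=> tv; rewrite /tan_comb; split.
- move=> f g U oU Ux fg rf; apply: eq_bigr => i _; congr (_ * _).
  by have [H _ _ _] := tv i; exact: H oU Ux fg rf.
- move=> f g rf rg; rewrite -big_split; apply: eq_bigr => i _ /=.
  by rewrite -mulrDr; congr (_ * _); have [_ H _ _] := tv i; apply: H.
- move=> a f rf; rewrite big_distrr; apply: eq_bigr => i _ /=.
  by rewrite mulrCA; congr (_ * _); have [_ _ H _] := tv i; apply: H.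
- move=> f g rf rg; rewrite !big_distrr -big_split; apply: eq_bigr => i _ /=.
  by have [_ _ _ H] := tv i; rewrite H // mulrDr !(mulrCA (c i)).
Qed.

End Tangent.

Lemma tangent_pushforward (K : fieldType) (S T : space K) (phi : S -> T) x D :
  morphism phi -> is_tangent x D ->
  is_tangent (phi x) (fun f => D (fun y => f (phi y))).
Proof.
move=> [ophi rphi] [Dnear Dadd Dscale Dmul]; split.
- move=> f g U oU Ux fg rf; apply: (Dnear _ _ (fun y => U (phi y))) => //.
  + exact: ophi.
  + by move=> y; apply: fg.
  + exact: rphi.
- by move=> f g /rphi rf /rphi rg; apply: Dadd.
- by move=> c f /rphi rf; apply: Dscale.
- by move=> f g /rphi rf /rphi rg; apply: Dmul.
Qed.

(** * Sections on a product and restriction to slices *)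

Section ProductSections.
Context (K : fieldType) (S T : space K) (U : S -> Prop) (V : T -> Prop).

Lemma prod_section_fst f : (forall x, U x -> regular_at x f) ->
  prod_section U V (fun p => f p.1).
Proof.
move=> rf; exists unit, (fun _ => f), (fun _ _ => 1).
split=> // [_ y _|x y _ _].
  exact: regular_const.
by rewrite (big_pred1 tt) ?mulr1 // => -[].
Qed.

Lemma prod_section_snd f : (forall y, V y -> regular_at y f) ->
  prod_section U V (fun p => f p.2).
Proof.
move=> rf; exists unit, (fun _ _ => 1), (fun _ => f).
split=> // [_ x _|x y _ _].
  exact: regular_const.
by rewrite (big_pred1 tt) ?mul1r // => -[].
Qed.

Lemma prod_section_meval m (z : 'I_m -> S * T -> K) (P : {mpoly K[m]}) :
  (forall i, prod_section U V (z i)) ->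
  prod_section U V (fun p => P.@[fun i => z i p]).
Proof.
move=> sz; elim/mpoly_ring_ind: P => [c|i|P Q sP sQ|P Q sP sQ].
- have -> : (fun p => (c%:MP_[m]).@[fun i => z i p]) = fun _ => c.
    by apply: functional_extensionality => y; rewrite mevalC.
  exact: prod_section_const.
- suff -> : (fun p => ('X_i).@[fun i => z i p]) = z i by [].
  by apply: functional_extensionality => y; rewrite mevalXU.
- have -> : (fun p => (P + Q).@[fun i => z i p]) =
      fun p => P.@[fun i => z i p] + Q.@[fun i => z i p].
    by apply: functional_extensionality => y; rewrite mevalD.
  exact: prod_sectionD.
- have -> : (fun p => (P * Q).@[fun i => z i p]) =
      fun p => P.@[fun i => z i p] * Q.@[fun i => z i p].
    by apply: functional_extensionality => y; rewrite mevalM.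
  exact: prod_sectionM.
Qed.

Lemma prod_section_slice g x y : is_open U -> U x -> V y ->
  prod_section U V g -> regular_at x (fun s => g (s, y)).
Proof.
move=> oU Ux Vy [I [a [b [ra rb eg]]]].
apply: (@regular_local _ _ _ (fun s => \sum_i a i s * b i y) _ _ oU Ux).
  by move=> s Us; rewrite eg.
apply: regular_sum => i; apply: regularM; last exact: regular_const.
exact: ra.
Qed.

End ProductSections.

(** Freezing y turns a sum of a_i(x) b_i(y) into a linear combination of the a_i. Composed with an
    action, this makes the orbit map of y a morphism, along which d/dt can be pushed forward. *)
Lemma slice_morphism (K : fieldType) (S T : space K) (y : T) :
  @morphism K S (prod_space S T) (fun x => (x, y)).
Proof.
split=> [W oW|x f [A [g [h [[U [V [oU oV eA sg sh]] Ax hx fE]]]]]].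
  apply: open_locally => x /oW[A [g [h [[U [V [oU oV eA sg sh]] Ax hx AW]]]]].
  have [Ux Vy] := (eA _).1 Ax.
  have [U' [oU' U'x U'h]] := regular_neq0 (prod_section_slice oU Ux Vy sh) hx.
  exists (fun s => U s /\ U' s); split=> //; first exact: openI.
  by move=> s [Us U's]; apply: AW (U'h _ U's); apply/eA.
have [Ux Vy] := (eA _).1 Ax.
have rh := prod_section_slice oU Ux Vy sh.
have [U' [oU' U'x U'h]] := regular_neq0 rh hx.
apply: (@regular_local _ _ _ (fun s => g (s, y) * (h (s, y))^-1) _
  (fun s => U s /\ U' s)) => //.
- exact: openI.
- by move=> s [Us /U'h hs]; rewrite fE //; apply/eA.
- by apply: regularM; [exact: prod_section_slice sg | exact: regularV].
Qed.

Lemma comp_morphism (K : fieldType) (R S T : space K)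
    (psi : S -> T) (phi : R -> S) :
  morphism psi -> morphism phi -> morphism (fun x => psi (phi x)).
Proof.
move=> [opsi rpsi] [ophi rphi].
by split=> [U /opsi/ophi|x f /rpsi/rphi].
Qed.

(** * Points, open sets and regular functions of the complement *)

Section Complement.
Context (K : closedFieldType) (n : nat) (q : {mpoly K[n.+1]}).
Hypotheses (two_neq0 : 2%:R != 0 :> K) (q_homog : q \is 2.-homog).

Local Notation b := (bil (qform_mx q)).
Local Notation Y := (subspace (predC (quadric q))).
Implicit Types (x u v w : 'rV[K]_n.+1) (y : Y) (F G : {mpoly K[n.+1]}).

(** The chosen vector carries no regularity in y; only expressions invariant under rescaling it are
    used as functions on Y. *)
Definition coords y : 'rV[K]_n.+1 := vpick (val (val y)).

Local Notation "F `( v )" := (F.@[fun i => v 0 i]) (at level 10).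

Lemma meval_rVZ d F c v : F \is d.-homog -> F `(c *: v) = c ^+ d * F `(v).
Proof.
move=> hF; rewrite -(meval_homogZ c _ hF); apply: meval_eq => i.
by rewrite mxE.
Qed.

Lemma coords_neq0 y : b (coords y) (coords y) != 0.
Proof. by rewrite -qform_mxE //; exact: (valP y). Qed.

Lemma coords_line y : val (val y) = <[coords y]>%VS.
Proof.
have v0 : coords y != 0.
  by apply: contraNneq (coords_neq0 y) => ->; rewrite bil0l.
have /eqP dimL : \dim (val (val y)) == 1%N := valP (val y).
by apply/esym/eqP; rewrite eqEdim dim_vline v0 dimL andbT; apply: memv_pick.
Qed.

Lemma coords_inj y y' c : c != 0 -> coords y = c *: coords y' -> y = y'.
Proof.
move=> c0 e; apply/val_inj/val_inj; rewrite !coords_line e.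
apply/eqP; rewrite eqEdim !dim_vline scaler_eq0 (negPf c0) leqnn andbT.
by rewrite -memvE memvZ ?memv_line.
Qed.

(** The existence is informative so as to define [point]. The scalar is there because the vector
    picked on the line of v need not be v. *)
Lemma point_exists v : b v v != 0 ->
  {y | exists2 c, c != 0 & coords y = c *: v}.
Proof.
move=> bv; have v0 : v != 0 by apply: contraNneq bv => ->; rewrite bil0l.
have dimv : \dim <[v]> == 1%N by rewrite dim_vline v0.
have /vlineP/sig_eqW[c ec] := memv_pick <[v]>%VS.
have c0 : c != 0.
  have : vpick <[v]>%VS != 0 by rewrite vpick0 -dimv_eq0 (eqP dimv).
  by apply: contraNneq => c0; rewrite ec c0 scale0r.
pose L : proj_space K n := Sub <[v]>%VS dimv.
have YL : predC (quadric q) L.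
  rewrite /= /quadric /form_eval /= ec (meval_rVZ _ _ q_homog) qform_mxE //.
  by rewrite mulf_neq0 ?expf_neq0.
by exists (Sub L YL), c.
Qed.

Definition point v (bv : b v v != 0) : Y := sval (point_exists bv).

Lemma coords_point v (bv : b v v != 0) :
  exists2 c, c != 0 & coords (point bv) = c *: v.
Proof. exact: svalP (point_exists bv). Qed.

Lemma open_formP (U : Y -> Prop) y : is_open U -> U y ->
  exists d G, [/\ G \is d.-homog, G `(coords y) != 0 &
    forall y', G `(coords y') != 0 -> U y'].
Proof.
move=> [V [oV eV]] /eV/oV[A [g [h [[d [F [G [_ hG AT _ eh]]]] _ hy AV]]]].
exists d, G; split=> //; first by rewrite eh in hy.
by move=> y' Gy'; apply/eV/AV; rewrite ?eh.
Qed.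

Lemma form_open d G : G \is d.-homog ->
  @is_open _ Y (fun y => G `(coords y) != 0).
Proof.
move=> hG; exists (fun L => form_eval G L != 0); split=> // L GL.
exists (fun _ => True), (form_eval G), (form_eval G); split=> //.
by exists d, G, G.
Qed.

(** The fraction represents f only inside some open V of the projective space. Multiplying both
    forms by a form H whose nonvanishing locus lies in V lets the denominator alone control the
    domain. *)
Lemma regular_formP f y : regular_at y f ->
  exists d F G, [/\ F \is d.-homog, G \is d.-homog, G `(coords y) != 0 &
    forall y', G `(coords y') != 0 -> f y' = F `(coords y') / G `(coords y')].
Proof.
move=> [V [g [oV Vy [A [k [l [[d [F [G [hF hG AT ek el]]]] _ ly gE]]]] fg]]].
have [A' [_ [h [[d' [_ [H [_ hH AT' _ eh]]]] _ hy AV]]]] := oV _ Vy.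
exists (d + d')%N, (F * H), (G * H); split; try exact: dhomogM.
  by rewrite mevalM mulf_neq0 //; [rewrite el in ly | rewrite eh in hy].
move=> y'; rewrite !mevalM mulf_eq0 negb_or => /andP[Gy' Hy'].
rewrite fg; last by apply/AV; rewrite ?eh.
by rewrite gE // ?el // ek -mulf_div divff // mulr1.
Qed.

Lemma form_regular d F G y : F \is d.-homog -> G \is d.-homog ->
  G `(coords y) != 0 ->
  @regular_at _ Y y (fun y' => F `(coords y') / G `(coords y')).
Proof.
move=> hF hG Gy.
exists (fun _ => True), (fun L => form_eval F L / form_eval G L).
split=> //; first exact: openT.
exists (fun _ => True), (form_eval F), (form_eval G); split=> //.
by exists d, F, G.
Qed.

(** * Affine charts of the complement and tangent vectors in them *)

Definition linear_form x : {mpoly K[n.+1]} :=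
  \sum_j (x *m qform_mx q) 0 j *: 'X_j.

Lemma linear_form_homog x : linear_form x \is 1.-homog.
Proof.
by apply: rpred_sum => j _; apply: dhomogZ; rewrite dhomogX /= mdeg1.
Qed.

Lemma linear_formE x v : (linear_form x) `(v) = b x v.
Proof.
rewrite bilE [LHS]raddf_sum; apply: eq_bigr => j _.
by rewrite [LHS]mevalZ mevalXU.
Qed.

Lemma linear_form_open x : @is_open _ Y (fun y => b x (coords y) != 0).
Proof.
suff -> : (fun y => b x (coords y) != 0 : Prop) =
          (fun y => (linear_form x) `(coords y) != 0 : Prop).
  exact: form_open (linear_form_homog x).
by apply: functional_extensionality => y; rewrite linear_formE.
Qed.

(** The representative normalized by b(x, -) = 1: affine coordinates off the hyperplane orthogonal
    to x, independent of the vector chosen on the line. On that hyperplane the value is 0, as the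
    inverse of 0 is 0. *)
Definition chart x y : 'rV[K]_n.+1 := (b x (coords y))^-1 *: coords y.

Lemma chart_regular x y i : b x (coords y) != 0 ->
  regular_at y (fun y' => chart x y' 0 i).
Proof.
move=> xy; have hX : ('X_i : {mpoly K[n.+1]}) \is 1.-homog.
  by rewrite dhomogX /= mdeg1.
have := form_regular hX (linear_form_homog x) (y := y).
rewrite linear_formE => /(_ xy); apply: (regular_local (openT Y)) => // y' _.
by rewrite mevalXU linear_formE mxE mulrC.
Qed.

Lemma meval_chart d F x y : F \is d.-homog ->
  F `(chart x y) = (b x (coords y))^-1 ^+ d * F `(coords y).
Proof. exact: meval_rVZ. Qed.

(** Near y a regular function is F / G with forms of equal degree, and these may be evaluated at the
    chart vector instead of [coords]. The quotient rule then reduces everything to the chart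
    coordinates. *)
Lemma tangent_chart_eq x y D D' : b x (coords y) != 0 ->
  is_tangent y D -> is_tangent y D' ->
  (forall i, D (fun y' => chart x y' 0 i) = D' (fun y' => chart x y' 0 i)) ->
  tan_eq y D D'.
Proof.
move=> xy tD tD' Dz f rf; have [d [F [G [hF hG Gy fE]]]] := regular_formP rf.
have rz i := chart_regular i xy.
have chart0 (P : {mpoly K[n.+1]}) y' : P \is d.-homog -> P `(coords y') != 0 ->
    b x (coords y') != 0 -> P `(chart x y') != 0.
  move=> hP Py xy'.
  by rewrite (meval_chart _ _ hP) mulf_neq0 ?expf_neq0 ?invr_eq0.
pose U y' := G `(coords y') != 0 /\ b x (coords y') != 0.
have oU : is_open U by apply: openI (form_open hG) (linear_form_open x).
have fz y' : U y' -> f y' * G `(chart x y') = F `(chart x y').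
  move=> [Gy' xy']; rewrite fE // !(meval_chart _ _ hF) !(meval_chart _ _ hG).
  by rewrite mulrCA divfK.
have rG := regular_meval G rz.
rewrite !(tangent_quotient (D := _) _ oU _ fz rf rG) //; last first.
all: try exact: chart0.
by rewrite !(tangent_meval_eq _ tD tD' rz Dz).
Qed.

(** * The additive group action attached to an isotropic vector *)

Section Action.
Variables (x u : 'rV[K]_n.+1).
Hypotheses (x_neq0 : b x x != 0) (u_neq0 : u != 0) (xu : b x u = 0)
  (uu : b u u = 0).

Let sym : forall v w, b v w = b w v := qform_mx_sym q.

(* exp (t N), where N v = b u v *: x - b x v *: u. *)
Definition unipotent (t : K) v : 'rV[K]_n.+1 :=
  v + (t * b u v) *: x
    + (- (t * b x v) - t ^+ 2 / 2%:R * b x x * b u v) *: u.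

Let ux : b u x = 0. Proof. by rewrite sym. Qed.

Lemma bil_u_unipotent t v : b u (unipotent t v) = b u v.
Proof. by rewrite !bilDr !bilZr ux uu !mulr0 !addr0. Qed.

Lemma bil_x_unipotent t v :
  b x (unipotent t v) = b x v + t * b u v * b x x.
Proof. by rewrite !bilDr !bilZr xu mulr0 addr0. Qed.

Lemma bil_unipotent t v : b (unipotent t v) (unipotent t v) = b v v.
Proof.
rewrite {2}/unipotent !bilDr !bilZr [b _ u]sym bil_u_unipotent.
rewrite [b _ x]sym bil_x_unipotent [b _ v]sym /unipotent !bilDr !bilZr.
rewrite [b v x]sym [b v u]sym; field.
exact: two_neq0.
Qed.

Lemma unipotent0 v : unipotent 0 v = v.
Proof.
by rewrite /unipotent !mul0r expr0n /= !mul0r oppr0 addr0 !scale0r !addr0.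
Qed.

Lemma unipotentD s t v : unipotent (s + t) v = unipotent s (unipotent t v).
Proof.
rewrite {2}/unipotent bil_u_unipotent bil_x_unipotent; apply/rowP => i.
rewrite !mxE; field; exact: two_neq0.
Qed.

Lemma unipotentZ t c v : unipotent t (c *: v) = c *: unipotent t v.
Proof.
by apply/rowP => i; rewrite /unipotent !bilZr !mxE; field; exact: two_neq0.
Qed.

Lemma unipotent_x t : unipotent t x = x - (t * b x x) *: u.
Proof.
by rewrite /unipotent ux !mulr0 scale0r subr0 addr0 scaleNr.
Qed.

Lemma action_subproof t y :
  b (unipotent t (coords y)) (unipotent t (coords y)) != 0.
Proof. by rewrite bil_unipotent coords_neq0. Qed.

Definition action t y : Y := point (action_subproof t y).

Lemma coords_action t y :
  exists2 c, c != 0 & coords (action t y) = c *: unipotent t (coords y).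
Proof. exact: coords_point. Qed.

Lemma action0 y : action 0 y = y.
Proof.
have [c c0 e] := coords_action 0 y.
by apply: (coords_inj c0); rewrite e unipotent0.
Qed.

Lemma actionD s t y : action (s + t) y = action s (action t y).
Proof.
have [c c0 e] := coords_action (s + t) y.
have [c1 c10 e1] := coords_action s (action t y).
have [c2 c20 e2] := coords_action t y.
(* The two sides are represented by c and c1 c2 times the same vector. *)
apply: (@coords_inj _ _ (c / (c1 * c2))).
  by rewrite mulf_neq0 ?invr_eq0 ?mulf_neq0.
by rewrite e e1 e2 unipotentZ !scalerA -unipotentD -mulrA divfK ?mulf_neq0.
Qed.

Lemma coords_action_chart t x' y : b x' (coords y) != 0 ->
  exists2 c, c != 0 & coords (action t y) = c *: unipotent t (chart x' y).
Proof.
move=> xy; have [c c0 e] := coords_action t y; exists (c * b x' (coords y)).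
  exact: mulf_neq0.
by rewrite e unipotentZ scalerA mulfK.
Qed.

Lemma unipotent_chart_section x' i :
  @prod_section K (affine_line K) Y
    (fun _ => True) (fun y => b x' (coords y) != 0)
    (fun p => unipotent p.1 (chart x' p.2) 0 i).
Proof.
pose V y := b x' (coords y) != 0.
have st : @prod_section K (affine_line K) Y (fun _ => True) V (fun p => p.1).
  apply: (@prod_section_fst K (affine_line K) Y _ _ id) => s _.
  have := line_regular_poly s 'X; congr regular_at.
  by apply: functional_extensionality => t; rewrite hornerX.
have sz j : @prod_section K (affine_line K) Y (fun _ => True) V
    (fun p => chart x' p.2 0 j).
  pose f y := chart x' y 0 j.
  apply: (@prod_section_snd K (affine_line K) Y _ _ f) => y.
  exact: chart_regular.
have sb w : @prod_section K (affine_line K) Y (fun _ => True) V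
    (fun p => b w (chart x' p.2)).
  have := prod_section_meval (linear_form w) sz; congr prod_section.
  by apply: functional_extensionality => p; rewrite linear_formE.
have sc c := @prod_section_const K (affine_line K) Y (fun _ => True) V c.
(* The formula of [unipotent] with signs and squares written as products, so that closure under sums
   and products applies. *)
suff -> : (fun p : affine_line K * Y => unipotent p.1 (chart x' p.2) 0 i) =
  fun p => chart x' p.2 0 i + p.1 * b u (chart x' p.2) * x 0 i
    + (-1 * (p.1 * b x (chart x' p.2))
       + p.1 * p.1 * (- (b x x / 2%:R)) * b u (chart x' p.2)) * u 0 i.
  by do ?[apply: prod_sectionD | apply: prod_sectionM]; try exact: sc.
apply: functional_extensionality => p.
by rewrite !mxE; ring.
Qed.

Lemma meval_action_section x' F :
  @prod_section K (affine_line K) Y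
    (fun _ => True) (fun y => b x' (coords y) != 0)
    (fun p => F `(unipotent p.1 (chart x' p.2))).
Proof.
exact: prod_section_meval (fun i => unipotent_chart_section x' i).
Qed.

(** One scalar serves all forms of degree d, so it cancels in their quotients. *)
Lemma meval_action d t x' y : b x' (coords y) != 0 ->
  exists2 c, c != 0 & forall F, F \is d.-homog ->
    F `(coords (action t y)) = c * F `(unipotent t (chart x' y)).
Proof.
move=> xy; have [c c0 e] := coords_action_chart t xy.
exists (c ^+ d) => [|F hF]; first exact: expf_neq0.
by rewrite e (meval_rVZ _ _ hF).
Qed.

(** Around (t, y) the chart of [coords y] is available since b(y, y) != 0. There the pullback of F /
    G is the quotient of F and G at the moved chart vector, both sections on a box. *)
Lemma action_morphism :
  @morphism K (prod_space (affine_line K) Y) Y (fun p => action p.1 p.2).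
Proof.
have chart_fr x' F G : prod_fr
    (fun p : affine_line K * Y => b x' (coords p.2) != 0)
    (fun p => F `(unipotent p.1 (chart x' p.2)))
    (fun p => G `(unipotent p.1 (chart x' p.2))).
  exists (fun _ => True), (fun y => b x' (coords y) != 0).
  split; [exact: openT | exact: linear_form_open | by move=> p; split=> [|[]]
         | exact: meval_action_section | exact: meval_action_section].
split=> [W oW [t y] Wty|[t y] f rf].
  have [d [G [hG Gty GW]]] := open_formP oW Wty.
  do 3 eexists.
  split; [exact: (chart_fr (coords y) G G) | exact: coords_neq0 | |].
    have [c _ e] := meval_action d t (coords_neq0 y).
    by apply: contraNneq Gty => /= G0; rewrite e // G0 mulr0.
  move=> [s y'] /= yy' Gsy; apply: GW.
  by have [c c0 ->] := meval_action d s yy' => //; rewrite mulf_neq0.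
have [d [F [G [hF hG Gty fE]]]] := regular_formP rf.
do 3 eexists.
split; [exact: (chart_fr (coords y) F G) | exact: coords_neq0 | |].
  have [c _ e] := meval_action d t (coords_neq0 y).
  by apply: contraNneq Gty => /= G0; rewrite e // G0 mulr0.
move=> [s y'] /= yy' Gsy; have [c c0 e] := meval_action d s yy'.
by rewrite fE !e ?mulf_neq0 // -mulf_div divff // mul1r.
Qed.

(** If t fixes the line of x, then x = c (x - t b(x,x) u). Pairing with x, which is orthogonal to u,
    forces c = 1, and then t = 0. *)
Lemma action_effective y : coords y = x -> effective action.
Proof.
move=> ey t /(_ y) fix_y; have [c _] := coords_action t y.
rewrite fix_y ey unipotent_x => e.
have /(congr1 (b x)) := e; rewrite bilZr bilDr bilNr bilZr xu mulr0 subr0.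
rewrite -[LHS]mul1r => /(mulIf x_neq0) c1; move: e; rewrite -c1 scale1r.
move/eqP; rewrite -subr_eq0 opprB addrC subrK scaler_eq0 (negPf u_neq0) orbF.
by rewrite mulf_eq0 (negPf x_neq0) orbF => /eqP.
Qed.

Lemma action_Ga : Ga_action action.
Proof. by split; [exact: action_morphism|exact: action0|exact: actionD]. Qed.

Definition orbit_der (y : Y) (f : Y -> K) : K :=
  line_d0 (fun t => f (action t y)).

Lemma orbit_der_tangent y : is_tangent y (orbit_der y).
Proof.
have := tangent_pushforward
  (comp_morphism action_morphism (@slice_morphism K (affine_line K) Y y))
  (line_d0_tangent K).
(* The pushforward is based at [action 0 y], which is y. *)
by rewrite /= action0.
Qed.

Lemma orbit_derP y : orbit_tangent action y (orbit_der y).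
Proof. by exists (@line_d0 K); split; [exact: line_d0_tangent|]. Qed.

(** Since b(x, u) = 0, the normalizing factor is constant along the orbit of x, which in the chart
    is the straight line x / b(x,x) - t u. *)
Lemma orbit_der_chart y i : coords y = x ->
  orbit_der y (fun y' => chart x y' 0 i) = - u 0 i.
Proof.
move=> ey; pose p := (x 0 i / b x x)%:P - u 0 i *: 'X.
transitivity (line_d0 (fun t => p.[t])).
  congr line_d0; apply: functional_extensionality => t.
  have [c c0 e] := coords_action t y; rewrite /chart e ey unipotent_x.
  rewrite bilZr bilDr bilNr bilZr xu mulr0 subr0 /p !hornerE !mxE /=; field.
  by rewrite x_neq0.
by rewrite line_d0_poly derivB derivC derivZ derivX !hornerE.
Qed.

End Action.

(** * Decomposition of tangent vectors into orbit velocities *)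

Lemma tangent_chart_orthogonal y D : is_tangent y D ->
  b (coords y) (\row_i D (fun y' => chart (coords y) y' 0 i)) = 0.
Proof.
move=> tD; have [Dnear _ Dscale _] := tD; rewrite bilE.
have rz i := chart_regular i (coords_neq0 y).
transitivity (D (fun y' => b (coords y) (chart (coords y) y'))).
  have -> : (fun y' => b (coords y) (chart (coords y) y')) = fun y' =>
      \sum_j (coords y *m qform_mx q) 0 j * chart (coords y) y' 0 j.
    by apply: functional_extensionality => y'; rewrite bilE.
  rewrite (tangent_sum _ tD) => [|i].
    by apply: eq_bigr => i _; rewrite mxE Dscale.
  exact: regularM (regular_const _ _) (rz i).
(* The function b(y, chart) is constantly 1 near y, so its derivative vanishes. *)
rewrite -[RHS](tangent_const 1 tD).
symmetry; apply: Dnear (linear_form_open (coords y)) (coords_neq0 y) _ _.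
  by move=> y' yy'; rewrite /chart bilZr mulVf.
exact: regular_const.
Qed.

Lemma complement_flexible_at y : (3 <= qform_rank q)%N -> flexible_at y.
Proof.
move=> rk D tD; set x := coords y; have x0 := coords_neq0 y.
pose d := \row_i D (fun y' => chart x y' 0 i).
have xd : b x d = 0 by exact: tangent_chart_orthogonal.
have [d0|d0] := eqVneq d 0.
  (* The zero vector is the empty combination; only a nonzero one is split into nonzero isotropic
     vectors, as effectiveness requires. *)
  exists 0%N, (fun _ => 0), (fun _ _ => 0); split=> [[]//|].
  apply: (tangent_chart_eq (x := x)) => // [|i].
    by apply: tan_comb_tangent => -[].
  move/rowP/(_ i): d0; rewrite !mxE => ->.
  by rewrite /tan_comb big_ord0.
(* The vector to split is -d, because the action of u has chart velocity -u. *)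
have Nd0 : - d != 0 by rewrite oppr_eq0.
have xNd : b x (- d) = 0 by rewrite bilNr xd oppr0.
have [u [v [eqd [u0 xu uu] [v0 xv vv]]]] :=
  isotropic_sum rk (qform_mx_sym q) two_neq0 x0 xNd Nd0.
pose Du := orbit_der xu uu y; pose Dv := orbit_der xv vv y.
exists 2%N, (fun _ => 1), (fun i => if i == 0 then Du else Dv); split.
  move=> i; case: ifP => _.
    exists (action xu uu); split; [exact: action_Ga| |exact: orbit_derP].
    exact: (@action_effective x u x0 u0 xu uu y erefl).
  exists (action xv vv); split; [exact: action_Ga| |exact: orbit_derP].
  exact: (@action_effective x v x0 v0 xv vv y erefl).
apply: (tangent_chart_eq (x := x)) => // [|i].
  by apply: tan_comb_tangent => i; case: ifP => _; apply: orbit_der_tangent.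
rewrite /tan_comb !big_ord_recl big_ord0 /= addr0 !mul1r.
rewrite /Du /Dv !orbit_der_chart // -opprD.
by have /rowP/(_ i) := eqd; rewrite !mxE => <-; rewrite opprK.
Qed.

End Complement.

Theorem theorem5p7 (K : closedFieldType) (charK0 : [pchar K] =i pred0)
    (n : nat) (q : {mpoly K[n.+1]}) (q_homog : q \is 2.-homog)
    (q_rank : (3 <= qform_rank q)%N) :
  flexible (subspace (predC (quadric q))).
Proof.
move=> y _; apply: complement_flexible_at => //.
by apply/negP => two0; have := charK0 2; rewrite !inE two0.
Qed.
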